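(* Let $n\ge2$ and let $A,B,C\in M_n(\mathbb C)$ satisfy $\operatorname{diag}A=\operatorname{diag}B=\operatorname{diag}C$. The linear map $X_{A,B,C}\colon M_n\to M_n$ is the adjacency operator of a quantum graph if and only if (1) $B$ is a projector, and (2) the matrix $\begin{pmatrix}A_{ij}&C_{ij}\\ C_{ji}&A_{ji}\end{pmatrix}$ is a projector for all $i\ne j\in\{1,\dots,n\}$. In that case, the quantum graph is undirected if and only if (3) $\mathring A$ is self-adjoint and (4) $B=B^{T}$; and it has no loops if and only if (5) $\mathbf 1\in\ker B$.
   Context: $M_n=M_n(\mathbb C)$, with matrix units $E_{ij}$ and Hilbert–Schmidt inner product $\langle x,y\rangle=\mathrm{Tr}(x^\dagger y)$. ''Projector'' means orthogonal projector ($P=P^2=P^\dagger$). $\mathring A:=A-\operatorname{diag}A$ is $A$ with its diagonal set to zero; $\mathbf 1\in\mathbb C^n$ is the all-ones vector. The map $X_{A,B,C}$ is $$X_{A,B,C}(x)=\sum_{i\ne j}A_{ij}\,x_{jj}E_{ii}+\sum_{i,j}B_{ij}\,x_{ij}E_{ij}+\sum_{i\neq j}C_{ij}\,x_{ji}E_{ij}.$$ A quantum graph on $M_n$ is a linear map $G\colon M_n\to M_n$ (its adjacency operator) satisfying $\sum_{k} G(E_{ik})G(E_{kj})=G(E_{ij})$ for all $i,j$ (Schur idempotency, in the unnormalised convention) and $G(x^\dagger)=G(x)^\dagger$ for all $x$ (realness). It is undirected if $\mathrm{Tr}(G(x)y)=\mathrm{Tr}(xG(y))$ for all $x,y$ (equivalently,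 given realness, $G$ is self-adjoint for the Hilbert–Schmidt inner product). It has no loops if $\sum_k G(E_{ik})E_{kj}=0$ for all $i,j$. *)

(* Defs.v *)
From HB Require Import structures.
From mathcomp Require Import all_boot all_order all_algebra.
From mathcomp Require Export reals complex.

Set Implicit Arguments.
Unset Strict Implicit.
Unset Printing Implicit Defensive.

Import Order.TTheory GRing.Theory Num.Theory.

Local Open Scope ring_scope.
Local Open Scope sesquilinear_scope.

Section QuantumGraphs.
Variables (K : numClosedFieldType) (n : nat).
Implicit Types (A B C P x y : 'M[K]_n).

Definition is_projector P : Prop := P *m P = P /\ P \is hermsymmx.

Definition offdiag_part A : 'M[K]_n := A - diag_mx (\row_i A i i).

Definition mapX A B C x : 'M[K]_n :=
  \sum_(i < n) \sum_(j < n | i != j) (A i j * x j j) *: delta_mx i i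
  + \sum_(i < n) \sum_(j < n) (B i j * x i j) *: delta_mx i j
  + \sum_(i < n) \sum_(j < n | i != j) (C i j * x j i) *: delta_mx i j.

Lemma mapX_is_linear A B C : linear (mapX A B C).
Proof.
move=> a x y; rewrite /mapX !scalerDr !scaler_sumr.
rewrite [RHS]addrACA; congr (_ + _); first rewrite [RHS]addrACA; try congr (_ + _);
  rewrite -big_split; apply: eq_bigr => i _; rewrite scaler_sumr -big_split;
  by apply: eq_bigr => j _; rewrite /= !mxE mulrDr scalerDl mulrCA scalerA.
Qed.

HB.instance Definition _ A B C :=
  GRing.isLinear.Build K 'M[K]_n 'M[K]_n _ (mapX A B C) (mapX_is_linear A B C).

(* G is the adjacency operator of a quantum graph on M_n: it is Schur idempotent
   (for the unnormalised trace) and real. *)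
Definition quantum_graph (G : {linear 'M[K]_n -> 'M[K]_n}) : Prop :=
  (forall i j : 'I_n,
      \sum_(k < n) G (delta_mx i k) *m G (delta_mx k j) = G (delta_mx i j))
  /\ (forall x, G (x ^t*) = (G x) ^t*).

Definition undirected (G : {linear 'M[K]_n -> 'M[K]_n}) : Prop :=
  forall x y, \tr (G x *m y) = \tr (x *m G y).

Definition no_loops (G : {linear 'M[K]_n -> 'M[K]_n}) : Prop :=
  forall i j : 'I_n, \sum_(k < n) G (delta_mx i k) *m delta_mx k j = 0.

End QuantumGraphs.

(* Main.v *)
(** The data [(A, B, C)], with the diagonals of [A] and [C] discarded, are
    determined by the map [X_{A,B,C}], and the three operations involved in the
    axioms preserve this class of maps: the Schur square of [X_{A,B,C}] is
    [X_{A', B^2, C'}] with [A'_ij = A_ij^2 + C_ij C_ji] and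
    [C'_ij = C_ij (A_ij + A_ji)]; its conjugate [x |-> X(x^dagger)^dagger] is
    [X_{conj A, B^dagger, C^dagger}]; its transpose for the trace form is
    [X_{A^T, B^T, C}].  Each axiom then becomes an identity between coefficients. *)
Require Import Defs.
From mathcomp Require Import all_boot all_order all_algebra.
From mathcomp Require Import reals complex.

Local Open Scope ring_scope.

Import GRing.Theory Num.Theory.

Set Implicit Arguments.
Unset Strict Implicit.
Unset Printing Implicit Defensive.

Section MapX.
Local Open Scope sesquilinear_scope.
Variables (K : numClosedFieldType) (n : nat).
Implicit Types (A B C x y : 'M[K]_n).

(** * Entries of the map and its action on matrix units *)

Lemma mapXE A B C x i j :
  mapX A B C x i j = B i j * x i j +
    (if i == j then \sum_(k | i != k) A i k * x k k else C i j * x j i).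
Proof.
rewrite /mapX !mxE addrAC addrC; congr (_ + _).
  pose M := \matrix_(i, j) (B i j * x i j).
  transitivity (M i j); last by rewrite mxE.
  rewrite [M]matrix_sum_delta !summxE; apply: eq_bigr => a _.
  by rewrite !summxE; apply: eq_bigr => b _; rewrite !mxE.
rewrite !summxE (bigD1 i) //= [X in _ + X + _]big1 ?addr0; last first.
  move=> a ai; rewrite summxE big1 // => b _.
  by rewrite !mxE eq_sym (negbTE ai) mulr0.
rewrite [X in _ + X](bigD1 i) //= [X in _ + (_ + X)]big1 ?addr0; last first.
  move=> a ai; rewrite summxE big1 // => b _.
  by rewrite !mxE [i == a]eq_sym (negbTE ai) mulr0.
rewrite !summxE; have [<-|ij] := eqVneq i j.
  rewrite [X in _ + X]big1 ?addr0; last first.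
    by move=> b ib; rewrite !mxE (negbTE ib) andbF mulr0.
  by apply: eq_bigr => b _; rewrite !mxE !eqxx mulr1.
rewrite big1 ?add0r; last first.
  by move=> b ib; rewrite !mxE [j == i]eq_sym (negbTE ij) andbF mulr0.
rewrite (bigD1 j) //= big1 ?addr0 ?mxE ?eqxx ?mulr1 //.
by move=> b /andP[_ bj]; rewrite !mxE [j == b]eq_sym (negbTE bj) andbF mulr0.
Qed.

(** What [A] and [C] contribute to the image of the matrix unit at [(k, l)]: a diagonal unit is only
    seen by [A], an off-diagonal one is transposed and weighted by [C]. *)
Definition swap_part A C (k l : 'I_n) : 'M[K]_n :=
  if k == l then \sum_(a | a != k) A a k *: delta_mx a a
  else C l k *: delta_mx l k.

Lemma swap_partE A C k l i j :
  swap_part A C k l i j =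
    if k == l then ((i == j) && (i != k))%:R * A i k
    else ((i == l) && (j == k))%:R * C l k.
Proof.
rewrite /swap_part; have [_|_] := eqVneq k l; last by rewrite !mxE mulrC.
rewrite summxE; have [ik|ik] := boolP (i != k).
  rewrite (bigD1 i) //= big1 ?addr0 => [|a /andP[_ ai]].
    by rewrite !mxE eqxx mulrC eq_sym andbT.
  by rewrite !mxE eq_sym (negbTE ai) mulr0.
rewrite andbF mul0r big1 // => a ak; rewrite !mxE.
by move: ik; rewrite negbK => /eqP ->; rewrite eq_sym (negbTE ak) mulr0.
Qed.

Lemma mapX_delta A B C k l :
  mapX A B C (delta_mx k l) = B k l *: delta_mx k l + swap_part A C k l.
Proof.
apply/matrixP => i j; rewrite mapXE !mxE swap_partE; congr (_ + _).
  by case: (altP andP) => [[/eqP-> /eqP->]|_] //; rewrite !mulr0.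
have [<-{j}|ij] := eqVneq i j.
  rewrite andTb; have [<-{l}|kl] := eqVneq k l; last first.
    rewrite big1; last first.
      move=> a ia; rewrite mxE; have [->|_] := eqVneq a k; rewrite ?mulr0 //.
      by rewrite (negbTE kl) mulr0.
    have [->|_] := eqVneq i l; last by rewrite mul0r.
    by rewrite eq_sym (negbTE kl) mul0r.
  have [->|ik] := eqVneq i k.
    rewrite mul0r big1 // => a ka.
    by rewrite mxE eq_sym (negbTE ka) mulr0.
  rewrite (bigD1 k) //= big1 ?addr0 ?mxE ?eqxx ?mulr1 ?mul1r //.
  by move=> a /andP[_ ak]; rewrite mxE (negbTE ak) mulr0.
rewrite andbC; have [<-{l}|kl] := eqVneq k l.
  rewrite mul0r; have [ik|_] := eqVneq i k; last by rewrite mulr0.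
  by rewrite -ik [j == i]eq_sym (negbTE ij) mulr0.
by case: (altP andP) => [[/eqP-> /eqP->]|_] /=; rewrite ?mulr1 ?mul1r ?mulr0 ?mul0r.
Qed.

(** Each coefficient can be read off a single entry: [B i j] at [(i, j)] in the image of the unit at
    [(i, j)], where the swap part vanishes; for [i != j], [A i j] at [(i, i)] in the image of the
    unit at [(j, j)], and [C i j] at [(i, j)] in the image of the unit at [(j, i)]. *)
Lemma eq_mapX A B C A' B' C' :
  (forall k l, mapX A B C (delta_mx k l) = mapX A' B' C' (delta_mx k l)) <->
  B = B' /\ (forall i j, i != j -> A i j = A' i j /\ C i j = C' i j).
Proof.
split=> [E|[<- AC] k l]; last first.
  apply/matrixP => i j; rewrite !mapXE; congr (_ + _).
  have [_|ij] := eqVneq i j; last by rewrite (AC _ _ ij).2.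
  by apply: eq_bigr => a /AC[->].
split=> [|i j ij].
  apply/matrixP => i j; have /matrixP/(_ i j) := E i j.
  rewrite !mapX_delta !mxE !swap_partE !eqxx /= !mulr1 !andbF.
  have [<-|ij] := eqVneq i j; first by rewrite !mul0r !addr0.
  by rewrite !mul0r !addr0.
split.
  have /matrixP/(_ i i) := E j j.
  by rewrite !mapX_delta !mxE !swap_partE !eqxx (negbTE ij) /= !mulr0 !mul1r !add0r.
have /matrixP/(_ i j) := E j i.
rewrite !mapX_delta !mxE !swap_partE !eqxx [j == i]eq_sym (negbTE ij) /=.
by rewrite !mulr0 !mul1r !add0r.
Qed.

(** * The Schur square *)

(** Row [k] of [swap_part A C k j] is zero. This and its mirror image below, about column [k],
    remove the cross terms of the Schur square. *)
Lemma delta_mul_swap_part A C (i k j : 'I_n) :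
  delta_mx i k *m swap_part A C k j = 0.
Proof.
rewrite /swap_part; have [->|kj] := eqVneq k j.
  rewrite mulmx_sumr big1 // => a aj.
  by rewrite -scalemxAr mul_delta_mx_0 ?scaler0 // eq_sym.
by rewrite -scalemxAr mul_delta_mx_0 ?scaler0.
Qed.

Lemma swap_part_mul_delta A C (i k j : 'I_n) :
  swap_part A C i k *m delta_mx k j = 0.
Proof.
rewrite /swap_part; have [->|ik] := eqVneq i k.
  rewrite mulmx_suml big1 // => a aj.
  by rewrite -scalemxAl mul_delta_mx_0 ?scaler0.
by rewrite -scalemxAl mul_delta_mx_0 ?scaler0.
Qed.

Lemma swap_part_schur_square A C i j :
  \sum_k swap_part A C i k *m swap_part A C k j =
  swap_part (\matrix_(i, j) (A i j ^+ 2 + C i j * C j i))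
            (\matrix_(i, j) (C i j * (A i j + A j i))) i j.
Proof.
rewrite {3}/swap_part; have [<-{j}|ij] := eqVneq i j.
  (* The index [k = i] yields the squares [A a i ^+ 2]; each other index [k = a] yields
     [C a i * C i a] on the same diagonal unit, so the two sums merge term by term. *)
  rewrite (bigD1 i) //=.
  have -> : swap_part A C i i *m swap_part A C i i
            = \sum_(a | a != i) A a i ^+ 2 *: delta_mx a a.
    rewrite /swap_part eqxx mulmx_suml; apply: eq_bigr => a ai.
    rewrite -scalemxAl mulmx_sumr (bigD1 a) //= big1 ?addr0.
      by rewrite -scalemxAr mul_delta_mx scalerA.
    by move=> b /andP[_ ba]; rewrite -scalemxAr mul_delta_mx_0 ?scaler0 // eq_sym.
  rewrite -big_split; apply: eq_bigr => a ai.
  rewrite /swap_part [i == a]eq_sym (negbTE ai) /= -scalemxAl -scalemxAr.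
  by rewrite mul_delta_mx scalerA -scalerDl mxE.
have ji : j != i by rewrite eq_sym.
(* Only [k = i] and [k = j] survive: there one factor is diagonal, and it rescales the unit at
   [(j, i)] by [A j i] and [A i j] respectively. *)
rewrite (bigD1 i) //= (bigD1 j) //= big1 ?addr0; last first.
  move=> k /andP[ki kj]; rewrite /swap_part [i == k]eq_sym (negbTE ki) (negbTE kj).
  by rewrite -scalemxAl -scalemxAr mul_delta_mx_0 // !scaler0.
rewrite /swap_part !eqxx (negbTE ij) mulmx_suml mulmx_sumr.
rewrite (bigD1 j) //= big1 ?addr0; last first.
  move=> a /andP[_ aj].
  by rewrite -scalemxAl -scalemxAr mul_delta_mx_0 // !scaler0.
rewrite (bigD1 i) //= [X in _ + (_ + X)]big1 ?addr0; last first.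
  move=> a /andP[_ ai].
  by rewrite -scalemxAl -scalemxAr mul_delta_mx_0 1?eq_sym // !scaler0.
rewrite -!scalemxAl -!scalemxAr !mul_delta_mx !scalerA -scalerDl mxE.
by rewrite mulrDr [A j i * _]mulrC.
Qed.

Lemma mapX_schur_square A B C i j :
  \sum_k mapX A B C (delta_mx i k) *m mapX A B C (delta_mx k j) =
  mapX (\matrix_(i, j) (A i j ^+ 2 + C i j * C j i)) (B *m B)
       (\matrix_(i, j) (C i j * (A i j + A j i))) (delta_mx i j).
Proof.
rewrite [RHS]mapX_delta -swap_part_schur_square mxE scaler_suml -big_split.
apply: eq_bigr => k _; rewrite !mapX_delta mulmxDl !mulmxDr.
rewrite -!scalemxAl delta_mul_swap_part -!scalemxAr swap_part_mul_delta.
by rewrite mul_delta_mx !scaler0 addr0 add0r scalerA.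
Qed.

(** * Realness *)

Lemma adjmxE x i j : (x ^t* ) i j = (x j i)^*.
Proof. by rewrite !mxE. Qed.

Lemma mapX_adjoint A B C x :
  (mapX (map_mx Num.conj A) (B ^t*) (C ^t*) x) ^t* = mapX A B C (x ^t*).
Proof.
apply/matrixP => i j; rewrite adjmxE !mapXE !adjmxE rmorphD rmorphM /= conjCK.
congr (_ + _); rewrite [j == i]eq_sym; have [<-|ij] := eqVneq i j.
  rewrite rmorph_sum; apply: eq_bigr => a _.
  by rewrite rmorphM /= mxE adjmxE conjCK.
by rewrite rmorphM /= conjCK.
Qed.

Lemma linear_ext_delta (G H : {linear 'M[K]_n -> 'M[K]_n}) :
  (forall k l, G (delta_mx k l) = H (delta_mx k l)) -> G =1 H.
Proof.
move=> E x; rewrite [x]matrix_sum_delta !linear_sum; apply: eq_bigr => i _.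
by rewrite !linear_sum; apply: eq_bigr => j _; rewrite !linearZ /= E.
Qed.

Lemma mapX_realP A B C :
  (forall x, mapX A B C (x ^t*) = (mapX A B C x) ^t*) <->
  B \is hermsymmx /\
  (forall i j, i != j -> A i j = (A i j)^* /\ C i j = (C j i)^*).
Proof.
(* By [mapX_adjoint], realness says that the map equals its conjugate; on matrix units this is in
   the scope of [eq_mapX]. *)
transitivity (forall k l, mapX A B C (delta_mx k l) =
    mapX (map_mx Num.conj A) (B ^t*) (C ^t*) (delta_mx k l)).
  split=> [E k l|E x].
    by apply: (can_inj (@trmxCK _ _ _)); rewrite mapX_adjoint E.
  rewrite -mapX_adjoint; congr (_ ^t*); apply/esym; exact: linear_ext_delta.
apply: iff_trans (eq_mapX _ _ _ _ _ _) _; split=> -[EB EAC]; split.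
- by apply/is_hermitianmxP; rewrite expr0 scale1r.
- by move=> i j /EAC; rewrite !mxE.
- by have /is_hermitianmxP := EB; rewrite expr0 scale1r.
- by move=> i j /EAC; rewrite !mxE.
Qed.

(** * Undirectedness and absence of loops *)

(** The two entries are the trace pairings of the images with the units at [(p, q)] and [(k, l)].
    [C] stays untransposed because both sides carry the weight [C l k] when [p = k] and [q = l]. *)
Lemma mapX_transpose A B C k l p q :
  mapX A B C (delta_mx k l) q p = mapX A^T B^T C (delta_mx p q) l k.
Proof.
rewrite !mapX_delta !mxE !swap_partE !mxE; congr (_ + _).
  rewrite [q == k]eq_sym [p == l]eq_sym andbC.
  by case: (altP andP) => [[/eqP-> /eqP->]|_] //; rewrite !mulr0.
rewrite [q == p]eq_sym [l == k]eq_sym.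
have [<-{l}|kl] := eqVneq k l; have [<-{q}|pq] := eqVneq p q.
- by rewrite !andTb eq_sym; have [->|_] := eqVneq k p; rewrite ?mul0r.
- have [->|_] := eqVneq k q; last by rewrite !mul0r.
  by rewrite eq_sym (negbTE pq) !mul0r.
- have [->|_] := eqVneq p l; last by rewrite !mul0r.
  by rewrite eq_sym (negbTE kl) !mul0r.
- rewrite [q == l]eq_sym [p == k]eq_sym.
  by case: (altP andP) => [[/eqP-> /eqP->]|_] //; rewrite !mul0r.
Qed.

Lemma trace_mul_delta (M : 'M[K]_n) i j : \tr (M *m delta_mx i j) = M j i.
Proof.
rewrite /mxtrace (bigD1 j) //= big1 ?addr0 => [|a aj].
  rewrite mxE (bigD1 i) //= big1 ?addr0 => [|b bi].
    by rewrite mxE !eqxx mulr1.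
  by rewrite mxE (negbTE bi) mulr0.
by rewrite mxE big1 // => b _; rewrite mxE (negbTE aj) andbF mulr0.
Qed.

(** Both traces are bilinear in [x] and [y], so matrix units suffice, and pairing with a unit
    extracts an entry. *)
Lemma undirectedP (G : {linear 'M[K]_n -> 'M[K]_n}) :
  undirected G <->
  (forall k l p q, G (delta_mx k l) q p = G (delta_mx p q) l k).
Proof.
split=> [E k l p q|E x y].
  by rewrite -!trace_mul_delta E mxtrace_mulC.
rewrite [x]matrix_sum_delta linear_sum !mulmx_suml !linear_sum /=.
apply: eq_bigr => k _; rewrite linear_sum !mulmx_suml !linear_sum /=.
apply: eq_bigr => l _; rewrite linearZ /= -!scalemxAl !linearZ /=; congr (_ * _).
rewrite [y]matrix_sum_delta !linear_sum; apply: eq_bigr => p _.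
rewrite !linear_sum; apply: eq_bigr => q _; rewrite !linearZ /=; congr (_ * _).
by rewrite trace_mul_delta E mxtrace_mulC trace_mul_delta.
Qed.

Lemma undirected_mapX A B C :
  undirected (mapX A B C) <->
  B = B^T /\ (forall i j, i != j -> A i j = A j i).
Proof.
transitivity (forall k l, mapX A B C (delta_mx k l) = mapX A^T B^T C (delta_mx k l)).
  apply: iff_trans (undirectedP _) _; split=> [E p q|E k l p q] /=.
    by apply/matrixP => l k; rewrite -mapX_transpose; exact: E.
  by rewrite mapX_transpose E.
apply: iff_trans (eq_mapX _ _ _ _ _ _) _.
split=> -[EB EA]; split=> // i j /EA; rewrite ?mxE; first by case.
by [].
Qed.

(** Right multiplication by the unit at [(k, j)] kills the swap part, so the sum over [k] leaves
    only the row sums of [B]. *)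
Lemma no_loops_mapX A B C :
  no_loops (mapX A B C) <-> B *m (const_mx 1 : 'cV[K]_n) = 0.
Proof.
have E (i j : 'I_n) : \sum_k mapX A B C (delta_mx i k) *m delta_mx k j =
             (B *m (const_mx 1 : 'cV[K]_n)) i 0 *: delta_mx i j.
  rewrite mxE scaler_suml; apply: eq_bigr => k _.
  rewrite mapX_delta mulmxDl swap_part_mul_delta addr0 -scalemxAl mul_delta_mx.
  by rewrite mxE mulr1.
split=> [L|B1 i j]; last by rewrite [LHS]E B1 mxE scale0r.
apply/matrixP => i z; rewrite ord1.
have /matrixP/(_ i i) : _ = 0 := L i i.
by rewrite [in LHS]E !mxE !eqxx mulr1.
Qed.

(** * Projector conditions and the characterisation of quantum graphs *)

(** The idempotency equations are factored so as to match the coefficients of the Schur square, with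
    [a], [b], [c], [d] standing for [A i j], [C i j], [C j i], [A j i]. *)
Lemma projector2P (a b c d : K) :
  is_projector (block_mx a%:M b%:M c%:M d%:M : 'M[K]_(1 + 1)) <->
  [/\ a ^+ 2 + b * c = a, b * (a + d) = b, c * (a + d) = c
    & d ^+ 2 + b * c = d] /\ [/\ a = a^*, b = c^* & d = d^*].
Proof.
have scal (x y : K) : (x%:M = y%:M :> 'M_1) <-> x = y.
  by split=> [/matrixP/(_ 0 0)|->] //; rewrite !mxE.
rewrite /is_projector mulmx_block -!scalar_mxM -!raddfD /=.
split=> [[/eq_block_mx[/scal E1 /scal E2 /scal E3 /scal E4]]|].
  move=> /is_hermitianmxP; rewrite expr0 scale1r tr_block_mx map_block_mx.
  rewrite !tr_scalar_mx !map_scalar_mx => /eq_block_mx[/scal H1 /scal H2 _ /scal H4].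
  do !split=> //.
  - by rewrite mulrDr mulrC.
  - by rewrite mulrDr [c * d]mulrC.
  - by rewrite addrC [b * c]mulrC.
move=> [[E1 E2 E3 E4] [H1 H2 H4]]; split.
  congr block_mx; congr (_%:M).
  - by rewrite -[RHS]E1.
  - by rewrite -[RHS]E2 mulrDr [b * a]mulrC.
  - by rewrite -[RHS]E3 mulrDr [c * d]mulrC.
  - by rewrite -[RHS]E4 addrC [b * c]mulrC.
(* The lower left condition [c = b^*] is recovered by conjugating [b = c^*]. *)
apply/is_hermitianmxP; rewrite expr0 scale1r tr_block_mx map_block_mx.
by rewrite !tr_scalar_mx !map_scalar_mx /= -H1 -H2 -H4 H2 conjCK.
Qed.

Lemma quantum_graph_mapX A B C :
  quantum_graph (mapX A B C) <->
  is_projector B /\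
  (forall i j : 'I_n, i != j ->
     is_projector (block_mx (A i j)%:M (C i j)%:M
                            (C j i)%:M (A j i)%:M : 'M[K]_(1 + 1))).
Proof.
have schur : (forall i j, \sum_k mapX A B C (delta_mx i k) *m
      mapX A B C (delta_mx k j) = mapX A B C (delta_mx i j)) <->
    B *m B = B /\ (forall i j, i != j ->
      A i j ^+ 2 + C i j * C j i = A i j /\ C i j * (A i j + A j i) = C i j).
  transitivity (forall i j, mapX (\matrix_(i, j) (A i j ^+ 2 + C i j * C j i)) (B *m B)
       (\matrix_(i, j) (C i j * (A i j + A j i))) (delta_mx i j)
       = mapX A B C (delta_mx i j)).
    by split=> E i j; rewrite -E mapX_schur_square.
  apply: iff_trans (eq_mapX _ _ _ _ _ _) _.
  by split=> -[EB E]; split=> // i j /E; rewrite !mxE.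
split=> [[/schur[BB S] /mapX_realP[BH H]]|[[BB BH] P]].
  split=> // i j ij; have ji : j != i by rewrite eq_sym.
  (* The block matrix at [(i, j)] involves both orders of the pair, so the coefficient identities
     are taken at [(i, j)] and at [(j, i)]. *)
  have [[Sij Tij] [Sji Tji]] := (S _ _ ij, S _ _ ji).
  have [[Hij Lij] [Hji _]] := (H _ _ ij, H _ _ ji).
  by apply/projector2P; split; split=> //; rewrite 1?addrC // mulrC addrC.
split; [apply/schur | apply/mapX_realP]; split=> // i j /P/projector2P[].
  by case.
by move=> _ [].
Qed.

End MapX.

Theorem proposition3p10 (R : realType) (n : nat) (n_ge2 : (2 <= n)%N)
    (A B C : 'M[R[i]]_n)
    (diagAB : forall i : 'I_n, A i i = B i i)
    (diagBC : forall i : 'I_n, B i i = C i i) :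
  (quantum_graph (mapX A B C) <->
     is_projector B /\
     (forall i j : 'I_n, i != j ->
        is_projector (block_mx (A i j)%:M (C i j)%:M
                               (C j i)%:M (A j i)%:M : 'M[R[i]]_(1 + 1))))
  /\ (quantum_graph (mapX A B C) ->
        (undirected (mapX A B C) <->
           offdiag_part A \is hermsymmx /\ B = B^T)
        /\ (no_loops (mapX A B C) <->
              B *m (const_mx 1 : 'cV[R[i]]_n) = 0)).
Proof.
split=> [|[_ /mapX_realP[_ H]]]; first exact: quantum_graph_mapX.
split; last exact: no_loops_mapX.
apply: iff_trans (undirected_mapX _ _ _) _.
(* Realness of the graph, kept as [H], makes the off-diagonal entries of [A] real, so for them being
   Hermitian and being symmetric agree; the diagonal of [offdiag_part A] is zero. *)
suff herm : offdiag_part A \is hermsymmx <-> (forall i j, i != j -> A i j = A j i).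
  by split=> [[BT /herm]|[/herm AT]].
split=> [/is_hermitianmxP E i j ij|AT].
  have ji : j != i by rewrite eq_sym.
  move/matrixP/(_ i j): E; rewrite expr0 scale1r !mxE.
  by rewrite (negbTE ij) (negbTE ji) !subr0 -(H _ _ ji).1.
apply/is_hermitianmxP; rewrite expr0 scale1r; apply/matrixP => i j.
rewrite !mxE [j == i]eq_sym.
have [->|ij] := eqVneq i j; first by rewrite !subrr rmorph0.
by rewrite !subr0 -(AT _ _ ij) -(H _ _ ij).1.
Qed.
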